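(* Consider the estimation of an unknown vector $\psi\in\mathbb{R}^n$ from relative measurements $y_r=E_r^T\psi+w_r$ and $N_l$ absolute measurements $y_a=E_a^T\psi+E_a^Tw_a$, where $1\le N_l<n$ and $w_r,w_a$ are zero-mean with $\mathcal{E}(w_rw_r^T)=I$, $\mathcal{E}(w_aw_a^T)=D_\kappa^{-1}$, $\mathcal{E}(w_rw_a^T)=0$, and $D_\kappa=\mathrm{diag}(\kappa_1,\dots,\kappa_n)$ with all $\kappa_i>0$. Assume the relative measurement graph is connected, let $L=E_rE_r^T$ be its Laplacian, and let $D_x=E_aE_a^T=\mathrm{diag}(x)$, where $x\in\{0,1\}^n$ is the indicator vector of the set $\mathcal{I}_a$ of absolutely measured sensors. Then the covariance of the estimation error of the linear minimum variance unbiased estimate $\hat\psi$ of $\psi$ is $$\Sigma=\mathcal{E}\big((\psi-\hat\psi)(\psi-\hat\psi)^T\big)=(L+D_\kappa D_x)^{-1}.$$ Consequently, the problem of choosing $N_l$ sensors among $n$ to be equipped with absolute position measurements so as to minimize the variance $\mathrm{trace}(\Sigma)$ of the estimation error is equivalent to the noise-corrupted leader selection problem: minimize $\mathrm{trace}\big((L+D_\kappa D_x)^{-1}\big)$ over $x\in\{0,1\}^n$ subject to $\mathbf{1}^Tx=N_l$.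
   Context: $\mathcal{E}$ denotes expectation and $\mathbf{1}$ the all-ones vector. There are $n$ sensors with scalar positions $\psi_1,\dots,\psi_n$. $\mathcal{I}_r$ is the index set of $m$ pairs of distinct nodes between which relative measurements $y_{ij}=\psi_i-\psi_j+w_{ij}$ are taken; $E_r\in\mathbb{R}^{n\times m}$ has columns $e_{ij}$, $(i,j)\in\mathcal{I}_r$, where $e_{ij}\in\mathbb{R}^n$ has $1$ in position $i$, $-1$ in position $j$, and zeros elsewhere. The relative measurement graph is the undirected graph on $n$ nodes with edges $\mathcal{I}_r$. $\mathcal{I}_a\subseteq\{1,\dots,n\}$ is the index set of the $N_l$ sensors whose absolute positions are measured, and $E_a\in\mathbb{R}^{n\times N_l}$ has as columns the unit vectors $e_i$, $i\in\mathcal{I}_a$. The linear minimum variance unbiased estimate is the estimate which, among linear functions of the full measurement vector $(y_r,y_a)$ that are unbiased for $\psi$, has minimum error variance. *)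

(* Defs.v *)
From HB Require Import structures.
From mathcomp Require Import all_boot all_order all_algebra.
From mathcomp Require Import all_classical all_reals all_analysis.

Set Implicit Arguments.
Unset Strict Implicit.
Unset Printing Implicit Defensive.

Import Order.TTheory GRing.Theory Num.Theory.
Import numFieldNormedType.Exports.

Local Open Scope ring_scope.

Section random_matrices.
Context d (T : measurableType d) (R : realType) (P : probability T R).

Definition rvec p (w : 'I_p -> {RV P >-> R}) (t : T) : 'cV[R]_p :=
  \col_i w i t.

(* Entrywise expectation. The entries are extended reals, so an equation
   Emx M = map_mx EFin A says in particular that the expectations are finite. *)
Definition Emx p q (M : T -> 'M[R]_(p, q)) : 'M[\bar R]_(p, q) :=
  \matrix_(i, j) 'E_P[fun t => M t i j]%E.

End random_matrices.

Section sensor_network.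
Context (R : realType) (n : nat).

Definition unit_vec (i : 'I_n) : 'cV[R]_n := delta_mx i 0.

Definition diag (v : 'cV[R]_n) : 'M[R]_n := diag_mx v^T.

(* The columns are numbered by the enumeration of Ir. *)
Definition Er (Ir : {set 'I_n * 'I_n}) : 'M[R]_(n, #|Ir|) :=
  \matrix_(i, k) (unit_vec (enum_val k).1 - unit_vec (enum_val k).2) i 0.

Definition Ea (Ia : {set 'I_n}) : 'M[R]_(n, #|Ia|) :=
  \matrix_(i, k) unit_vec (enum_val k) i 0.

Definition indicator_vec (Ia : {set 'I_n}) : 'cV[R]_n :=
  \col_i (i \in Ia)%:R.

Definition measurement_graph (Ir : {set 'I_n * 'I_n}) : rel 'I_n :=
  fun i j => ((i, j) \in Ir) || ((j, i) \in Ir).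

Definition graph_connected (e : rel 'I_n) : Prop := forall i j, connect e i j.

(* An edge {i, j} with both (i, j) and (j, i) in Ir, i.e. measured twice, has
   weight 2. *)
Definition laplacian (Ir : {set 'I_n * 'I_n}) : 'M[R]_n := Er Ir *m (Er Ir)^T.

Definition leader_feasible (N : nat) (x : 'cV[R]_n) : Prop :=
  (forall i, x i 0 = 0 \/ x i 0 = 1) /\
  (const_mx 1 : 'cV[R]_n)^T *m x = (N%:R)%:M.

End sensor_network.

Section estimation.
Context d (T : measurableType d) (R : realType) (P : probability T R).
Context (n : nat) (Ir : {set 'I_n * 'I_n}).
Context (wr : 'I_#|Ir| -> {RV P >-> R}) (wa : 'I_n -> {RV P >-> R}).
Context (Ia : {set 'I_n}).

Definition yr (psi : 'cV[R]_n) (t : T) : 'cV[R]_#|Ir| :=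
  (Er R Ir)^T *m psi + rvec wr t.

Definition ya (psi : 'cV[R]_n) (t : T) : 'cV[R]_#|Ia| :=
  (Ea R Ia)^T *m psi + (Ea R Ia)^T *m rvec wa t.

Definition estimate (K : 'M[R]_(n, #|Ir| + #|Ia|)) (psi : 'cV[R]_n) (t : T) :
    'cV[R]_n :=
  K *m col_mx (yr psi t) (ya psi t).

(* psi is an unknown deterministic vector: unbiasedness is required for each of
   its possible values. *)
Definition unbiased (K : 'M[R]_(n, #|Ir| + #|Ia|)) : Prop :=
  forall psi, Emx P (estimate K psi) = map_mx EFin psi.

Definition error_cov (K : 'M[R]_(n, #|Ir| + #|Ia|)) (psi : 'cV[R]_n) :
    'M[\bar R]_n :=
  Emx P (fun t => (psi - estimate K psi t) *m (psi - estimate K psi t)^T).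

Definition error_variance (K : 'M[R]_(n, #|Ir| + #|Ia|)) (psi : 'cV[R]_n) :
    \bar R :=
  \tr (error_cov K psi).

Definition is_lmvu (K : 'M[R]_(n, #|Ir| + #|Ia|)) : Prop :=
  unbiased K /\
  forall K', unbiased K' ->
    forall psi, (error_variance K psi <= error_variance K' psi)%E.

(* The default value 0 is only relevant when no such estimator exists. *)
Definition lmvu : 'M[R]_(n, #|Ir| + #|Ia|) :=
  xget 0 [set K | is_lmvu K]%classic.

End estimation.

Section optimization.
Context (R : realType) (X Y : Type).

Definition is_argmin (Z : Type) (F : Z -> Prop) (f : Z -> \bar R) (z : Z) :
    Prop :=
  F z /\ forall z', F z' -> (f z <= f z')%E.

(* Minimizing f over F is equivalent to minimizing g over G: phi is a bijection
   between the feasible sets that preserves the objective and the minimizers. *)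
Definition equivalent_min (phi : X -> Y) (F : X -> Prop) (f : X -> \bar R)
    (G : Y -> Prop) (g : Y -> \bar R) : Prop :=
  [/\ forall x, F x -> G (phi x),
      forall y, G y -> exists! x, F x /\ phi x = y,
      forall x, F x -> f x = g (phi x)
    & forall x, F x -> (is_argmin F f x <-> is_argmin G g (phi x))].

End optimization.

(* Main.v *)
(* Stack the measurements as y = H psi + e, where e has mean 0 and diagonal
   covariance V.  A linear estimate K y is unbiased iff K H = 1, its error then
   has covariance K V K^T, and with G := H^T V^-1 H and K0 := G^-1 H^T V^-1,
     K V K^T = G^-1 + (K - K0) V (K - K0)^T,
   so that K0 is the only minimizer of the trace and its covariance is G^-1.
   Here G = L + Dkappa Dx, which is invertible because the graph is connected
   and at least one node is measured absolutely. *)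
Require Import Defs.
From mathcomp Require Import all_boot all_order all_algebra.
From mathcomp Require Import all_classical all_reals all_analysis.
From mathcomp Require Import measurable_realfun.

Set Implicit Arguments.
Unset Strict Implicit.
Unset Printing Implicit Defensive.

Import Order.TTheory GRing.Theory Num.Theory.

Local Open Scope ring_scope.

(** * Weighted quadratic forms and Gram matrices *)

Section weighted_least_squares.
Context (F : realFieldType).

Lemma mxtrace_diag_form m p (v : 'rV[F]_p) (D : 'M[F]_(m, p)) :
  \tr (D *m diag_mx v *m D^T) = \sum_i \sum_k v 0 k * D i k ^+ 2.
Proof.
apply: eq_bigr => i _; rewrite mul_mx_diag mxE; apply: eq_bigr => k _.
by rewrite !mxE mulrAC mulrC expr2.
Qed.

Lemma mxtrace_diag_form_ge0 m p (v : 'rV[F]_p) (D : 'M[F]_(m, p)) :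
  (forall k, 0 < v 0 k) -> 0 <= \tr (D *m diag_mx v *m D^T).
Proof.
move=> v_gt0; rewrite mxtrace_diag_form.
apply: sumr_ge0 => i _; apply: sumr_ge0 => k _.
by rewrite mulr_ge0 ?sqr_ge0 ?ltW.
Qed.

(** Definiteness: the trace is a sum of squares of all entries of [D] with positive weights, so it
    cannot be nonpositive unless every entry vanishes. *)
Lemma mxtrace_diag_form_eq0 m p (v : 'rV[F]_p) (D : 'M[F]_(m, p)) :
  (forall k, 0 < v 0 k) -> \tr (D *m diag_mx v *m D^T) <= 0 -> D = 0.
Proof.
move=> v_gt0 tr_le0.
have t0 k i : 0 <= v 0 k * D i k ^+ 2 by rewrite mulr_ge0 ?sqr_ge0 ?ltW.
have /eqP : \tr (D *m diag_mx v *m D^T) = 0.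
  by apply: le_anti; rewrite tr_le0 mxtrace_diag_form_ge0.
rewrite mxtrace_diag_form psumr_eq0 => [/allP Di|i _]; last exact: sumr_ge0.
apply/matrixP => i j; rewrite mxE.
have /= := Di i (mem_index_enum i).
rewrite psumr_eq0 // => /allP /(_ j (mem_index_enum j)) /=.
by rewrite mulf_eq0 sqrf_eq0 gt_eqF //= => /eqP.
Qed.

Lemma invmx_eq n (A B : 'M[F]_n) : A *m B = 1%:M -> invmx A = B.
Proof.
move=> AB1; have [Au _] := mulmx1_unit AB1.
by rewrite -[RHS](mulKmx Au) AB1 mulmx1.
Qed.

Lemma mul_diag_mxV p (v : 'rV[F]_p) :
  (forall k, 0 < v 0 k) ->
  diag_mx v *m diag_mx (map_mx GRing.inv v) = 1%:M.
Proof.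
move=> v_gt0; rewrite mulmx_diag -diag_const_mx; congr diag_mx.
by apply/rowP => k; rewrite !mxE divff // gt_eqF.
Qed.

(** If [u] is in the left kernel of the Gram matrix, multiplying by [u^T] makes the weighted form of
    [u *m H^T] vanish; definiteness and the injectivity of [H] then give [u = 0]. *)
Lemma gram_unit n p (H : 'M[F]_(p, n)) (w : 'rV[F]_p) :
  (forall k, 0 < w 0 k) ->
  (forall u : 'rV[F]_n, u *m H^T = 0 -> u = 0) ->
  H^T *m diag_mx w *m H \in unitmx.
Proof.
move=> w_gt0 Hinj; rewrite -row_free_unit; apply: inj_row_free => u uG0.
apply: Hinj; apply: (@mxtrace_diag_form_eq0 _ _ w) => //.
by rewrite trmx_mul trmxK (mulmxA _ H) -2!(mulmxA u) uG0 mul0mx mxtrace0.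
Qed.

(** * The Gauss-Markov theorem for a diagonal noise covariance *)

Section gauss_markov.
Context (n p : nat) (H : 'M[F]_(p, n)) (v : 'rV[F]_p).
Hypothesis v_gt0 : forall k, 0 < v 0 k.
Let W : 'M[F]_p := diag_mx (map_mx GRing.inv v).
Let G : 'M[F]_n := H^T *m W *m H.
Hypothesis G_unit : G \in unitmx.

(** The generalized least squares gain, weighting each measurement by its inverse noise variance. *)
Definition gls_gain : 'M[F]_(n, p) := invmx G *m H^T *m W.

Lemma gls_gain_unbiased : gls_gain *m H = 1%:M.
Proof. by rewrite /gls_gain -!mulmxA (mulmxA H^T) mulVmx. Qed.

(** With V the diagonal covariance and K0 = [gls_gain], W V = 1 gives K0 V = G^-1 H^T. Hence K0 V
    M^T = G^-1 (M H)^T = G^-1 whenever M H = 1. Taking M = K and M = K0, all terms of the expanded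
    square except K V K^T equal G^-1 up to sign. *)
Lemma gls_cov_decomp (K : 'M[F]_(n, p)) : K *m H = 1%:M ->
  K *m diag_mx v *m K^T =
  invmx G + (K - gls_gain) *m diag_mx v *m (K - gls_gain)^T.
Proof.
move=> KH1.
have Vsym : (diag_mx v)^T = diag_mx v by rewrite tr_diag_mx.
have WV : W *m diag_mx v = 1%:M by rewrite diag_mxC mul_diag_mxV.
have K0V : gls_gain *m diag_mx v = invmx G *m H^T.
  by rewrite /gls_gain -!mulmxA WV mulmx1.
have cross (M : 'M[F]_(n, p)) :
    M *m H = 1%:M -> gls_gain *m diag_mx v *m M^T = invmx G.
  by move=> MH; rewrite K0V -mulmxA -trmx_mul MH trmx1 mulmx1.
have Gsym : (invmx G)^T = invmx G.
  by rewrite trmx_inv /G !trmx_mul trmxK tr_diag_mx mulmxA.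
have cross' : K *m diag_mx v *m gls_gain^T = invmx G.
  by apply: trmx_inj; rewrite trmx_mul trmxK trmx_mul Vsym Gsym mulmxA cross.
rewrite linearB /= mulmxBr !mulmxBl cross' !cross ?gls_gain_unbiased //.
by rewrite subrr subr0 addrC subrK.
Qed.

Lemma gls_cov : gls_gain *m diag_mx v *m gls_gain^T = invmx G.
Proof. by rewrite gls_cov_decomp ?gls_gain_unbiased // subrr !mul0mx addr0. Qed.

Lemma gls_gain_optimal (K : 'M[F]_(n, p)) : K *m H = 1%:M ->
  \tr (invmx G) <= \tr (K *m diag_mx v *m K^T).
Proof.
move=> KH1; rewrite (gls_cov_decomp KH1) mxtraceD lerDl.
exact: mxtrace_diag_form_ge0.
Qed.

(** The excess over the optimum is the weighted form of [K - gls_gain], so definiteness turns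
    equality of the traces into equality of the gains. *)
Lemma gls_gain_unique (K : 'M[F]_(n, p)) : K *m H = 1%:M ->
  \tr (K *m diag_mx v *m K^T) <= \tr (invmx G) -> K = gls_gain.
Proof.
move=> KH1; rewrite (gls_cov_decomp KH1) mxtraceD gerDl => tr_le0.
by apply/eqP; rewrite -subr_eq0 (mxtrace_diag_form_eq0 v_gt0 tr_le0).
Qed.

End gauss_markov.
End weighted_least_squares.

(** * Expectations of random matrices *)

Section random_matrices.
Context d (T : measurableType d) (R : realType) (P : probability T R).

(** The expectation is the difference of the integrals of the positive and negative parts. In the
    extended reals a finite difference forces both to be finite, hence also their sum, the integral
    of |f|. This is how the moment hypotheses yield the integrability that linearity of the
    expectation requires. *)
Lemma integrable_of_fin_num_expectation (f : T -> R) :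
  measurable_fun setT f -> ('E_P[f])%E \is a fin_num ->
  P.-integrable setT (EFin \o f).
Proof.
move=> /measurable_EFinP mf.
rewrite expectation.unlock integralE fin_numB => /andP[fp fn].
apply/integrableP; split => //.
under eq_integral do rewrite -/((abse \o (EFin \o f)) _) fune_abse.
rewrite ge0_integralD //=; last 2 first.
- exact: measurable_funepos.
- exact: measurable_funeneg.
by rewrite lte_add_pinfty // ltey_eq ?fp ?fn.
Qed.

(** Integrability is carried along with the value, so that sums, constant multiples and blocks can
    be handled compositionally. *)
Definition has_mean p q (X : T -> 'M[R]_(p, q)) (A : 'M[R]_(p, q)) :=
  forall i j, P.-integrable setT (fun t => (X t i j)%:E) /\
              ('E_P[fun t => X t i j] = (A i j)%:E)%E.

Lemma has_meanE p q (X : T -> 'M[R]_(p, q)) A :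
  has_mean X A -> Emx P X = map_mx EFin A.
Proof. by move=> XA; apply/matrixP => i j; rewrite !mxE (XA i j).2. Qed.

Lemma Emx_has_mean p q (X : T -> 'M[R]_(p, q)) A :
  (forall i j, measurable_fun setT (fun t => X t i j)) ->
  Emx P X = map_mx EFin A -> has_mean X A.
Proof.
move=> mX EX i j; have := congr1 (fun M : 'M[\bar R]_(p, q) => M i j) EX.
rewrite !mxE => Eij; split => //.
apply: integrable_of_fin_num_expectation; first exact: mX.
by rewrite Eij.
Qed.

Lemma has_mean_cst p q (A : 'M[R]_(p, q)) : has_mean (cst A) A.
Proof.
move=> i j; split; first exact: finite_measure_integrable_cst.
exact: expectation_cst.
Qed.

Lemma has_meanD p q (X Y : T -> 'M[R]_(p, q)) A B :
  has_mean X A -> has_mean Y B -> has_mean (fun t => X t + Y t) (A + B).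
Proof.
move=> XA YB i j; have [iX eX] := XA i j; have [iY eY] := YB i j.
move: eX eY; rewrite expectation.unlock mxE => eX eY.
have -> : (fun t => ((X t + Y t) i j)%:E) =
          ((fun t => (X t i j)%:E) \+ (fun t => (Y t i j)%:E))%E.
  by apply/funext => t; rewrite mxE.
split; first exact: integrableD.
by rewrite integralD // eX eY.
Qed.

Lemma has_mean_mull m p q (B : 'M[R]_(m, p)) (X : T -> 'M[R]_(p, q)) A :
  has_mean X A -> has_mean (fun t => B *m X t) (B *m A).
Proof.
move=> XA i j; rewrite expectation.unlock.
have iBX k : P.-integrable setT (fun t => ((B i k)%:E * (X t k j)%:E)%E).
  by apply: integrableZl => //; exact: (XA k j).1.
have -> : (fun t => ((B *m X t) i j)%:E) =
          (fun t => \sum_k ((B i k)%:E * (X t k j)%:E)%E)%R.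
  by apply/funext => t; rewrite mxE -sumEFin.
split; first exact: integrable_sum.
rewrite integral_sum // mxE -sumEFin; apply: eq_bigr => k _.
rewrite integralZl //; last exact: (XA k j).1.
by move: (XA k j).2; rewrite expectation.unlock => ->.
Qed.

Lemma has_mean_tr p q (X : T -> 'M[R]_(p, q)) A :
  has_mean X A -> has_mean (fun t => (X t)^T) A^T.
Proof.
move=> XA i j; have [iX eX] := XA j i; rewrite mxE.
by split; under eq_fun do rewrite mxE.
Qed.

Lemma has_mean_mulr m p q (B : 'M[R]_(q, m)) (X : T -> 'M[R]_(p, q)) A :
  has_mean X A -> has_mean (fun t => X t *m B) (A *m B).
Proof.
move=> XA.
have -> : (fun t => X t *m B) = (fun t => (B^T *m (X t)^T)^T).
  by apply/funext => t; rewrite trmx_mul !trmxK.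
have -> : A *m B = (B^T *m A^T)^T by rewrite trmx_mul !trmxK.
exact/has_mean_tr/has_mean_mull/has_mean_tr.
Qed.

Lemma has_mean_col p1 p2 q (X : T -> 'M[R]_(p1, q)) (Y : T -> 'M[R]_(p2, q))
    A B :
  has_mean X A -> has_mean Y B ->
  has_mean (fun t => col_mx (X t) (Y t)) (col_mx A B).
Proof.
move=> XA YB i j; rewrite !mxE.
by split; under eq_fun do rewrite mxE;
  case: (fintype.split i) => k; do [exact: (XA k j).1|exact: (XA k j).2
                           |exact: (YB k j).1|exact: (YB k j).2].
Qed.

Lemma has_mean_row p q1 q2 (X : T -> 'M[R]_(p, q1)) (Y : T -> 'M[R]_(p, q2))
    A B :
  has_mean X A -> has_mean Y B ->
  has_mean (fun t => row_mx (X t) (Y t)) (row_mx A B).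
Proof.
move=> /has_mean_tr XA /has_mean_tr YB.
have -> : (fun t => row_mx (X t) (Y t)) =
          (fun t => (col_mx (X t)^T (Y t)^T)^T).
  by apply/funext => t; rewrite tr_col_mx !trmxK.
rewrite -[row_mx A B]trmxK tr_row_mx.
exact/has_mean_tr/has_mean_col.
Qed.

Lemma measurable_rvec_outer p q (w : 'I_p -> {RV P >-> R})
    (z : 'I_q -> {RV P >-> R}) i j :
  measurable_fun setT (fun t => (rvec w t *m (rvec z t)^T) i j).
Proof.
have -> : (fun t => (rvec w t *m (rvec z t)^T) i j) = (w i \* z j)%R.
  by apply/funext => t; rewrite !mxE big_ord1 !mxE.
exact: measurable_funM.
Qed.

Lemma measurable_rvec p (w : 'I_p -> {RV P >-> R}) i j :
  measurable_fun setT (fun t => rvec w t i j).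
Proof.
have -> : (fun t => rvec w t i j) = w i by apply/funext => t; rewrite mxE.
exact: measurable_funPT.
Qed.

Lemma mxtrace_EFin p (A : 'M[R]_p) : \tr (map_mx EFin A) = (\tr A)%:E.
Proof. by rewrite /mxtrace -sumEFin; apply: eq_bigr => i _; rewrite mxE. Qed.

End random_matrices.

(** * Incidence matrices, the information matrix and indicator vectors *)

Section sensor_network.
Context (R : realType) (n : nat).
Implicit Types (Ir : {set 'I_n * 'I_n}) (Ia : {set 'I_n}) (kappa : 'cV[R]_n).

(** The columns of [Ea] are unit vectors, hence eigenvectors of a diagonal matrix; the right factor
    lists their eigenvalues along the enumeration of [Ia]. *)
Lemma diag_mul_Ea kappa Ia :
  diag kappa *m Ea R Ia =
  Ea R Ia *m diag_mx (\row_k kappa (enum_val k) 0).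
Proof.
rewrite mul_diag_mx mul_mx_diag; apply/matrixP => i k; rewrite !mxE eqxx andbT.
by case: eqP => [->|_]; rewrite ?mulr1 ?mul1r ?mulr0 ?mul0r.
Qed.

Lemma trmx_Ea_mul_Ea Ia : (Ea R Ia)^T *m Ea R Ia = 1%:M.
Proof.
apply/matrixP => k l; rewrite !mxE (bigD1 (enum_val k)) //= !mxE !eqxx mul1r.
rewrite big1 ?addr0 ?andbT => [|i /negPf ik].
  by rewrite (inj_eq enum_val_inj).
by rewrite !mxE ik mul0r.
Qed.

Lemma Ea_mul_trmx_Ea Ia : Ea R Ia *m (Ea R Ia)^T = diag (indicator_vec R Ia).
Proof.
apply/matrixP => i j; rewrite !mxE.
under eq_bigr do rewrite !mxE !andbT.
(* The sum over column numbers becomes a sum over the nodes of [Ia]. *)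
rewrite -(big_enum_val (fun l => (i == l)%:R * (j == l)%:R)) /=.
have [iIa|iIa] := boolP (i \in Ia).
  rewrite (bigD1 i) //= eqxx mul1r big1 ?addr0 1?eq_sym //.
  by move=> l /andP[_ /negPf li]; rewrite eq_sym li mul0r.
rewrite big1 ?mul0rn // => l lIa.
by case: eqP iIa => [->|_]; rewrite ?lIa ?mul0r.
Qed.

Lemma diagV kappa : (forall i, 0 < kappa i 0) ->
  invmx (diag kappa) = diag (map_mx GRing.inv kappa).
Proof.
move=> kappa_gt0; apply: invmx_eq; rewrite /diag map_trmx mul_diag_mxV //.
by move=> k; rewrite mxE.
Qed.

(** The matrix H of the stacked measurement equation. *)
Definition obs_mx Ir Ia : 'M[R]_(#|Ir| + #|Ia|, n) :=
  col_mx (Er R Ir)^T (Ea R Ia)^T.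

(** The diagonal of V: unit variances for relative measurements, then inverse [kappa] at the nodes
    of [Ia]. *)
Definition noise_var Ir Ia kappa : 'rV[R]_(#|Ir| + #|Ia|) :=
  row_mx (const_mx 1) (\row_k (kappa (enum_val k) 0)^-1).

Lemma noise_var_gt0 Ir Ia kappa k :
  (forall i, 0 < kappa i 0) -> 0 < noise_var Ir Ia kappa 0 k.
Proof.
move=> kappa_gt0; rewrite mxE; case: fintype.split => l; rewrite !mxE //.
by rewrite invr_gt0.
Qed.

(** The weights being block diagonal, the two kinds of measurements contribute separately. The
    relative block gives the Laplacian; in the absolute block the weights move across [Ea] as
    [diag kappa], leaving [Ea *m Ea^T]. *)
Lemma information_mxE Ir Ia kappa :
  (obs_mx Ir Ia)^T *m diag_mx (map_mx GRing.inv (noise_var Ir Ia kappa)) *m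
    obs_mx Ir Ia =
  laplacian R Ir + diag kappa *m diag (indicator_vec R Ia).
Proof.
rewrite map_row_mx diag_mx_row tr_col_mx !trmxK mul_row_block !mulmx0 addr0 add0r.
rewrite mul_row_col map_const_mx invr1 diag_const_mx mulmx1.
congr (_ + _).
rewrite -Ea_mul_trmx_Ea mulmxA diag_mul_Ea; congr (_ *m diag_mx _ *m _).
by apply/rowP => k; rewrite !mxE invrK.
Qed.

(* A vector killed by all the measurements is constant along the edges, and
   zero at some node. *)
Lemma obs_mx_inj Ir Ia (u : 'rV[R]_n) :
  graph_connected (measurement_graph Ir) -> (0 < #|Ia|)%N ->
  u *m (obs_mx Ir Ia)^T = 0 -> u = 0.
Proof.
move=> conn /card_gt0P[a aIa].
rewrite tr_col_mx !trmxK mul_mx_row -[0]row_mx0 => /eq_row_mx[uEr uEa].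
have edge i j : (i, j) \in Ir -> u 0 i = u 0 j.
  (* [k] numbers the column of [Er] belonging to (i, j), so entry [k] of [u *m Er] is the difference
     of [u] at i and j. *)
  move=> ijIr; pose k := enum_rank_in ijIr (i, j).
  have := congr1 (fun w : 'rV[R]_(#|Ir|) => w 0 k) uEr.
  rewrite !mxE.
  under eq_bigr do rewrite !mxE enum_rankK_in // !andbT mulrBr.
  rewrite sumrB /= (bigD1 i) //= eqxx mulr1 big1 ?addr0; last first.
    by move=> l /negPf ->; rewrite mulr0.
  rewrite (bigD1 j) //= eqxx mulr1 big1 ?addr0; last first.
    by move=> l /negPf ->; rewrite mulr0.
  by move/eqP; rewrite subr_eq0 => /eqP.
have ua : u 0 a = 0.
  have := congr1 (fun v : 'rV[R]_(#|Ia|) => v 0 (enum_rank_in aIa a)) uEa.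
  rewrite !mxE (bigD1 a) //= big1 ?addr0.
    by rewrite !mxE enum_rankK_in // !eqxx mulr1.
  by move=> l /negPf la; rewrite !mxE enum_rankK_in // la mulr0.
(* The zero set of [u] is closed under adjacency and contains [a], so connectedness makes it the
   whole graph. *)
have cl : fingraph.closed (measurement_graph Ir) [pred i | u 0 i == 0].
  by move=> i j /orP[] /edge; rewrite !inE => ->.
apply/rowP => i; rewrite mxE; apply/eqP.
by have := closed_connect cl (conn a i); rewrite !inE ua eqxx => <-.
Qed.

Lemma leader_feasible_indicator Ia :
  leader_feasible #|Ia| (indicator_vec R Ia).
Proof.
split=> [i|]; first by rewrite mxE; case: (i \in Ia); [right|left].
apply/matrixP => i j; rewrite !ord1 !mxE.
under eq_bigr do rewrite !mxE mul1r.
by rewrite -natr_sum -big_mkcond /= sum1_card.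
Qed.

Lemma leader_feasibleP N (x : 'cV[R]_n) : leader_feasible N x ->
  exists! Ia : {set 'I_n}, #|Ia| = N /\ indicator_vec R Ia = x.
Proof.
move=> [x01 sumx]; pose Ia := [set i | x i 0 == 1].
have xE : indicator_vec R Ia = x.
  apply/colP => i; rewrite mxE inE.
  by case: (x01 i) => ->; rewrite ?eqxx // eq_sym oner_eq0.
exists Ia; split=> [|Ja [_ JaE]].
  split=> //; have [_] := leader_feasible_indicator Ia.
  (* Both cardinalities are compared as elements of [R], where the embedding of the naturals is
     injective. *)
  rewrite xE sumx => /matrixP /(_ 0 0) /eqP; rewrite !mxE eqxx eqr_nat.
  by move/eqP.
apply/setP => i; rewrite inE -JaE mxE.
by case: (i \in Ja); rewrite ?eqxx // eq_sym oner_eq0.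
Qed.

End sensor_network.

(** * Unbiased linear estimates and their error covariance *)

Section estimation.
Context d (T : measurableType d) (R : realType) (P : probability T R).
Context (n : nat) (Ir : {set 'I_n * 'I_n}) (kappa : 'cV[R]_n).
Context (wr : 'I_#|Ir| -> {RV P >-> R}) (wa : 'I_n -> {RV P >-> R}).
Context (Ia : {set 'I_n}).
Hypothesis kappa_gt0 : forall i, 0 < kappa i 0.
Hypothesis mean_wr : Emx P (rvec wr) = map_mx EFin 0.
Hypothesis mean_wa : Emx P (rvec wa) = map_mx EFin 0.
Hypothesis cov_wr :
  Emx P (fun t => rvec wr t *m (rvec wr t)^T) = map_mx EFin 1%:M.
Hypothesis cov_wa :
  Emx P (fun t => rvec wa t *m (rvec wa t)^T) =
  map_mx EFin (invmx (diag kappa)).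
Hypothesis cov_wr_wa :
  Emx P (fun t => rvec wr t *m (rvec wa t)^T) = map_mx EFin 0.
Hypothesis conn : graph_connected (measurement_graph Ir).
Hypothesis Ia_gt0 : (0 < #|Ia|)%N.

Implicit Type K : 'M[R]_(n, #|Ir| + #|Ia|).

Let H := obs_mx R Ir Ia.
Let v := noise_var Ir Ia kappa.
Let info := laplacian R Ir + diag kappa *m diag (indicator_vec R Ia).

Definition noise (t : T) : 'cV[R]_(#|Ir| + #|Ia|) :=
  col_mx (rvec wr t) ((Ea R Ia)^T *m rvec wa t).

Lemma estimateE K psi t :
  estimate wr wa K psi t = K *m H *m psi + K *m noise t.
Proof.
by rewrite /estimate /yr /ya /noise -add_col_mx -mul_col_mx mulmxDr mulmxA.
Qed.

Lemma has_mean_noise : has_mean P noise 0.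
Proof.
rewrite -col_mx0 -[X in col_mx _ X](mulmx0 _ (Ea R Ia)^T).
apply: has_mean_col; last apply: has_mean_mull.
- by apply: Emx_has_mean => //; exact: measurable_rvec.
- by apply: Emx_has_mean => //; exact: measurable_rvec.
Qed.

Lemma has_mean_noise_outer :
  has_mean P (fun t => noise t *m (noise t)^T) (diag_mx v).
Proof.
have Mrr : has_mean P (fun t => rvec wr t *m (rvec wr t)^T) 1%:M.
  by apply: Emx_has_mean => //; exact: measurable_rvec_outer.
have Maa : has_mean P (fun t => rvec wa t *m (rvec wa t)^T) (invmx (diag kappa)).
  by apply: Emx_has_mean => //; exact: measurable_rvec_outer.
have Mra : has_mean P (fun t => rvec wr t *m (rvec wa t)^T) 0.
  by apply: Emx_has_mean => //; exact: measurable_rvec_outer.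
(* Only one cross covariance is assumed; the other is its transpose. *)
have Mar : has_mean P (fun t => rvec wa t *m (rvec wr t)^T) 0.
  have -> : (fun t => rvec wa t *m (rvec wr t)^T) =
            (fun t => (rvec wr t *m (rvec wa t)^T)^T).
    by apply/funext => t; rewrite trmx_mul trmxK.
  by rewrite -trmx0; exact: has_mean_tr.
have -> : (fun t => noise t *m (noise t)^T) =
    (fun t => col_mx
      (row_mx (rvec wr t *m (rvec wr t)^T)
              (rvec wr t *m (rvec wa t)^T *m Ea R Ia))
      (row_mx ((Ea R Ia)^T *m (rvec wa t *m (rvec wr t)^T))
              ((Ea R Ia)^T *m (rvec wa t *m (rvec wa t)^T) *m Ea R Ia))).
  apply/funext => t; rewrite /noise tr_col_mx mul_col_row trmx_mul trmxK.
  by rewrite /block_mx !mulmxA.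
have -> : diag_mx v =
    col_mx (row_mx 1%:M (0 *m Ea R Ia))
           (row_mx ((Ea R Ia)^T *m 0)
                   ((Ea R Ia)^T *m invmx (diag kappa) *m Ea R Ia)).
  (* In the absolute block the inverse of [diag kappa] is again diagonal, so it moves past [Ea], and
     the orthonormality of the columns of [Ea] leaves the restricted inverse variances. *)
  rewrite diag_mx_row diag_const_mx mul0mx mulmx0 diagV //.
  rewrite -mulmxA diag_mul_Ea mulmxA trmx_Ea_mul_Ea mul1mx /block_mx.
  by do 3!congr (_ _ _); apply/rowP => k; rewrite !mxE.
apply: has_mean_col; apply: has_mean_row => //.
- exact: has_mean_mulr.
- exact: has_mean_mull.
- exact/has_mean_mulr/has_mean_mull.
Qed.

(** Since the noise has mean zero, the estimate has mean K H psi; requiring this to be psi for every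
    psi determines K H. *)
Lemma unbiasedP K : unbiased wr wa K <-> K *m H = 1%:M.
Proof.
have meanK psi : Emx P (estimate wr wa K psi) = map_mx EFin (K *m H *m psi).
  apply: has_meanE; rewrite -[X in has_mean _ _ X]addr0 -(mulmx0 _ K).
  rewrite (_ : estimate _ _ _ _ = fun t => K *m H *m psi + K *m noise t).
    apply: has_meanD; [exact: has_mean_cst|].
    exact/has_mean_mull/has_mean_noise.
  by apply/funext => t; rewrite estimateE.
split=> [Ku|KH1 psi]; last by rewrite meanK KH1 mul1mx.
have KH (psi : 'cV[R]_n) : K *m H *m psi = psi.
  apply/colP => i; have := etrans (esym (meanK psi)) (Ku psi).
  by move=> /matrixP /(_ i 0); rewrite [LHS]mxE [RHS]mxE => -[].
move: KH; set M := K *m H => KH; apply/matrixP => i j.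
(* Taking psi to be a unit vector reads off column [j] of K H. *)
have /colP/(_ i) := KH (delta_mx j 0).
by rewrite -colE !mxE eqxx andbT.
Qed.

(** Unbiasedness cancels psi from the error, which becomes minus K applied to the noise. *)
Lemma error_covE K psi : unbiased wr wa K ->
  error_cov wr wa K psi = map_mx EFin (K *m diag_mx v *m K^T).
Proof.
move=> /unbiasedP KH1; apply: has_meanE.
rewrite (_ : (fun t => _) = fun t => K *m (noise t *m (noise t)^T) *m K^T).
  exact/has_mean_mulr/has_mean_mull/has_mean_noise_outer.
apply/funext => t; rewrite estimateE KH1 mul1mx opprD addNKr.
by rewrite linearN /= mulmxN mulNmx opprK trmx_mul !mulmxA.
Qed.

Lemma error_varianceE K psi : unbiased wr wa K ->
  error_variance wr wa K psi = (\tr (K *m diag_mx v *m K^T))%:E.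
Proof. by move=> Ku; rewrite /error_variance error_covE // mxtrace_EFin. Qed.

Lemma information_mx_unit : info \in unitmx.
Proof.
rewrite /info -information_mxE; apply: gram_unit => [k|u].
  by rewrite mxE invr_gt0 noise_var_gt0.
exact: obs_mx_inj.
Qed.

Lemma is_lmvuP K : is_lmvu wr wa K <-> K = gls_gain H v.
Proof.
have v_gt0 k : 0 < v 0 k by exact: noise_var_gt0.
have G_unit : H^T *m diag_mx (map_mx GRing.inv v) *m H \in unitmx.
  by rewrite information_mxE; exact: information_mx_unit.
have K0u : unbiased wr wa (gls_gain H v).
  by apply/unbiasedP; exact: gls_gain_unbiased.
split=> [[Ku Kmin]|->].
  apply: gls_gain_unique => //; first exact/unbiasedP.
  (* The variance of an unbiased estimate does not depend on psi, so comparing with the least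
     squares gain at psi = 0 suffices. *)
  by have := Kmin _ K0u 0; rewrite !error_varianceE // lee_fin gls_cov.
split=> // K' K'u psi; rewrite !error_varianceE // lee_fin gls_cov //.
by apply: gls_gain_optimal => //; exact/unbiasedP.
Qed.

Lemma lmvu_error_cov K psi : is_lmvu wr wa K ->
  error_cov wr wa K psi = map_mx EFin (invmx info).
Proof.
move=> Kopt; rewrite error_covE; last by case: Kopt.
have /is_lmvuP -> := Kopt.
rewrite gls_cov ?information_mxE //; first by move=> k; exact: noise_var_gt0.
exact: information_mx_unit.
Qed.

(** The least squares gain witnesses existence, so [xget] does not return its default value. *)
Lemma lmvuP : is_lmvu wr wa (lmvu wr wa Ia).
Proof.
apply: (@xgetPex _ 0 [set K | is_lmvu wr wa K]%classic).
by exists (gls_gain H v); apply/is_lmvuP.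
Qed.

End estimation.

(** * Equivalence of the two minimization problems *)

Lemma equivalent_min_bij (R : realType) (X Y : Type) (phi : X -> Y)
    (F : X -> Prop) (f : X -> \bar R) (G : Y -> Prop) (g : Y -> \bar R) :
  (forall x, F x -> G (phi x)) ->
  (forall y, G y -> exists! x, F x /\ phi x = y) ->
  (forall x, F x -> f x = g (phi x)) ->
  equivalent_min phi F f G g.
Proof.
move=> FG GF fg; split=> // x Fx; split=> -[Fx' xmin]; split=> //.
- exact: FG.
(* Each competitor in [G] is the image of a feasible [x'] with the same objective value, so
   minimality over [F] transfers. *)
- move=> y /GF[x' [[Fx'' <-] _]]; rewrite -!fg //; exact: xmin.
- by move=> x' Fx''; rewrite !fg //; apply: xmin; exact: FG.
Qed.

Theorem mainTheorem3 (R : realType) (d : measure_display)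
    (T : measurableType d) (P : probability T R)
    (n Nl : nat) (Ir : {set 'I_n * 'I_n}) (kappa : 'cV[R]_n)
    (wr : 'I_#|Ir| -> {RV P >-> R}) (wa : 'I_n -> {RV P >-> R})
    (psi : 'cV[R]_n)
    (hNl : (1 <= Nl < n)%N)
    (hIr : forall i j : 'I_n, (i, j) \in Ir -> i != j)
    (hkappa : forall i : 'I_n, 0 < kappa i 0)
    (mean_wr : Emx P (rvec wr) = map_mx EFin 0)
    (mean_wa : Emx P (rvec wa) = map_mx EFin 0)
    (cov_wr : Emx P (fun t => rvec wr t *m (rvec wr t)^T) = map_mx EFin 1%:M)
    (cov_wa : Emx P (fun t => rvec wa t *m (rvec wa t)^T) =
              map_mx EFin (invmx (diag kappa)))
    (cov_wr_wa : Emx P (fun t => rvec wr t *m (rvec wa t)^T) = map_mx EFin 0)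
    (hconn : graph_connected (measurement_graph Ir)) :
  let L := laplacian R Ir in
  let Dkappa := diag kappa in
  (forall Ia : {set 'I_n}, #|Ia| = Nl ->
    let Dx := diag (indicator_vec R Ia) in
    [/\ Ea R Ia *m (Ea R Ia)^T = Dx,
        exists! K, is_lmvu wr wa (Ia := Ia) K,
        L + Dkappa *m Dx \in unitmx
      & forall K, is_lmvu wr wa (Ia := Ia) K ->
          error_cov wr wa K psi = map_mx EFin (invmx (L + Dkappa *m Dx))]) /\
  equivalent_min (@indicator_vec R n)
    (fun Ia : {set 'I_n} => #|Ia| = Nl)
    (fun Ia => \tr (error_cov wr wa (lmvu wr wa Ia) psi))
    (leader_feasible Nl)
    (fun x => (\tr (invmx (L + Dkappa *m diag x)))%:E).
Proof.
have Nl_gt0 Ia : #|Ia| = Nl -> (0 < #|Ia|)%N by move=> ->; case/andP: hNl.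
move=> L Dkappa; split=> [Ia /Nl_gt0 Ia_gt0 Dx|].
  split.
  - exact: Ea_mul_trmx_Ea.
  - exists (gls_gain (obs_mx R Ir Ia) (noise_var Ir Ia kappa)).
    split=> [|K]; first exact/(is_lmvuP (kappa := kappa)).
    by move=> /(is_lmvuP (kappa := kappa)) ->.
  - exact: information_mx_unit.
  - by move=> K Kopt; exact: lmvu_error_cov.
apply: equivalent_min_bij => [Ia <-|x|Ia /Nl_gt0 Ia_gt0].
- exact: leader_feasible_indicator.
- exact: leader_feasibleP.
(* The gain selected by [lmvu] is a genuine minimizer, so its error covariance is the inverse
   information matrix and the objectives agree. *)
- rewrite -mxtrace_EFin; congr (\tr _).
  by apply: lmvu_error_cov => //; exact: (lmvuP (kappa := kappa)).
Qed.
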